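(* Let $G$ be an untagged $\mathfrak{sl}_n$ web with boundary weight vector $\vec k$, and let $f(G)=\sum_{S\in\mathcal{S}tr(G)} (-q)^{x(S)-y(S)} x_S\in V(\vec k)$. For any $S\in\mathcal{S}tr(G)$, the monomial $x_S$ has a nonzero coefficient in $f(G)$.
   Context: Webs. Fix $n\ge2$. An untagged $\mathfrak{sl}_n$ web is a finite directed plane graph embedded in the closed half-plane below a horizontal boundary axis, considered up to planar isotopy relative to the boundary, whose edges carry weights in $\{1,\dots,n-1\}$; boundary vertices are univalent and lie on the axis; all other (interior) vertices are trivalent; directed weighted closed loops without vertices are allowed as components. For a vertex $v$ and incident edge $e$ put $\sigma_v(e)=1$ if $e$ is directed into $v$ and $-1$ if out of $v$. At each interior vertex $v$ with incident edges $e_1,e_2,e_3$ of weights $\ell_1,\ell_2,\ell_3$ one requires $\sum_i\sigma_v(e_i)\ell_i\equiv 0 \pmod n$. If $v_1,\dots,v_m$ are the boundary vertices from left to right and $e_i$ is the edge at $v_i$, of weight $\ell_i$, the boundary weight vector is $\vec k=(k_1,\dots,k_m)$ with $k_i=\ell_i$ if $\sigma_{v_i}(e_i)=1$ and $k_i=n-\ell_i$ if $\sigma_{v_i}(e_i)=-1$. Strandings. A stranding $S$ of $G$ is a collection of directed paths in $G$ (simple strands), each with a color in $\{1,\dots,n-1\}$, each either closed or with both endpoints on the boundary, paths of the same color being pairwise disjoint. For an edge $e$, $S_+(e)$ (resp. $S_-(e)$) is the set of colors of strands running along $e$ with (resp. against) its direction, $S(e)=S_+(e)\sqcup S_-(e)$,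 and $\alpha_c^\vee(e)=1,-1,0$ according to $c\in S_+(e)$, $c\in S_-(e)$, $c\notin S(e)$. $S$ is valid if for every edge $e$ of weight $\ell$: (1) the nonzero values $\alpha_c^\vee(e)$ alternate in sign as $c$ increases; (2) with $c_{\max}$ the largest color in $S(e)$, $\sum_{c=1}^{n-1}\alpha_c^\vee(e)c$ equals $\ell$ if $c_{\max}\in S_+(e)$ and $\ell-n$ if $c_{\max}\in S_-(e)$ (in particular $S(e)\neq\emptyset$). $\mathcal{S}tr(G)$ is the set of valid strandings. $(i,j)$-strands. For $1\le i<j\le n$ the sum $\sum_{c=i}^{j-1}\alpha_c^\vee(e)$ lies in $\{-1,0,1\}$. The $(i,j)$-strands of $S$ are the connected components of the directed graph consisting of the edges $e$ for which this sum is nonzero, directed as $e$ if the sum is $1$ and oppositely to $e$ if it is $-1$; each is a directed closed curve or a directed path with endpoints on the boundary. An open strand is clockwise (counterclockwise) if the closed curve obtained by joining its endpoints along the axis is; thus an open strand is clockwise if it runs from its right endpoint to its left endpoint and counterclockwise otherwise. $x(S)$ is the total number, over all $i<j$, of closed clockwise $(i,j)$-strands; $y(S)$ is the total number, over all $i<j$, of counterclockwise $(i,j)$-strands, both closed and open. Binary labels and monomials. For $S\in\mathcal{S}tr(G)$ and an edge $e$, $b_S(e)\in\{0,1\}^n$ is defined by $b_S(e)_n=0$ if $\alpha^\vee_{c_{\max}}(e)=1$, $b_S(e)_n=1$ if $\alpha^\vee_{c_{\max}}(e)=-1$, and $b_S(e)_c-b_S(e)_{c+1}=\alpha_c^\vee(e)$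 for $1\le c\le n-1$. For the boundary edge $e_j$ let $\hat b(e_j)=b_S(e_j)$ if $\sigma_{v_j}(e_j)=1$ and $\hat b(e_j)=\vec 1-b_S(e_j)$ if $\sigma_{v_j}(e_j)=-1$, where $\vec 1=(1,\dots,1)$. Let $V_k$ be the $\mathbb C(q)$-vector space $\bigwedge_q^k\mathbb C_q^n$ with basis $x_{\vec b}$ indexed by $\vec b\in\{0,1\}^n$ with exactly $k$ ones, and $V(\vec k)=V_{k_1}\otimes\cdots\otimes V_{k_m}$. Put $x_S=x_{\hat b(e_1)}\otimes\cdots\otimes x_{\hat b(e_m)}$, an element of the monomial basis of $V(\vec k)$. Coefficients of $f(G)$ are taken in this monomial basis (different strandings may have the same monomial). *)

(* Defs.v *)
From HB Require Import structures.
From mathcomp Require Import all_boot all_order all_algebra.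
From mathcomp Require Import boolp reals complex.

Set Implicit Arguments.
Unset Strict Implicit.
Unset Printing Implicit Defensive.

Import Order.TTheory GRing.Theory Num.Theory.
Local Open Scope ring_scope.

(* Webs are plane graphs whose edges are drawn as polygonal arcs (and vertex-  *)
(* free loops as closed polygons) in the half-plane y <= 0.  A web is an       *)
(* isotopy class of such drawings; every class has polygonal representatives   *)
(* and everything below depends only on the class.                             *)

Record web_data (R : realType) := WebData {
  nbdry : nat;
  ivert : finType;
  arc : finType;
  loop : finType;
  tail : arc -> 'I_nbdry + ivert;
  head : arc -> 'I_nbdry + ivert;
  weight : arc + loop -> nat;
  (* abscissas of the boundary vertices, which lie on the axis y = 0 *)
  bpos : 'I_nbdry -> R;
  ipos : ivert -> R * R;
  (* For an arc: the successive intermediate corners, from tail to head.       *)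
  (* For a loop: all the corners of the closed polygon, in the direction of    *)
  (* the loop.                                                                 *)
  corners : arc + loop -> seq (R * R);
}.

Arguments arc {R} w.
Arguments loop {R} w.
Arguments ivert {R} w.
Arguments nbdry {R} w.

Section WebGeometry.
Variables (R : realType) (G : web_data R).

Definition vertex : finType := ('I_(nbdry G) + ivert G)%type.
Definition edge : finType := (arc G + loop G)%type.

(* (a, true) is the arc a run along its direction, (a, false) against it;      *)
(* alternatively, the half-edge of a at the vertex where this run ends.        *)
Definition half : finType := (arc G * bool)%type.
Definition tip (h : half) : vertex := if h.2 then head h.1 else tail h.1.
Definition opp (h : half) : half := (h.1, ~~ h.2).
Definition sigma (h : half) : int := if h.2 then 1 else -1.

Definition pos (v : vertex) : R * R :=
  match v with inl i => (bpos i, 0) | inr u => ipos u end.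

Definition polyline (e : edge) : seq (R * R) :=
  match e with
  | inl a => pos (tail a) :: rcons (corners e) (pos (head a))
  | inr _ => rcons (corners e) (seq.head (0, 0) (corners e))
  end.

Definition edge_point (e : edge) (k : nat) (t : R) : R * R :=
  let p := nth (0, 0) (polyline e) k in
  let p' := nth (0, 0) (polyline e) k.+1 in
  ((1 - t) * p.1 + t * p'.1, (1 - t) * p.2 + t * p'.2).

(* Parameters of the points of e that are not vertices of the graph; each      *)
(* segment of the polyline is taken without its final end point, and the       *)
(* initial point of an arc is left out.                                        *)
Definition inner_param (e : edge) (k : nat) (t : R) : bool :=
  [&& (k.+1 < size (polyline e))%N, 0 <= t, t < 1
    & if e is inl _ then (0 < k)%N || (0 < t) else true].

End WebGeometry.

Record web (R : realType) (n : nat) := Web {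
  web_graph :> web_data R;
  (* the unique half-edge at each boundary vertex *)
  leg : 'I_(nbdry web_graph) -> half web_graph;
  weight_bounds : forall e : edge web_graph, (0 < weight e < n)%N;
  boundary_univalent :
    forall (i : 'I_(nbdry web_graph)) (h : half web_graph),
      (tip h == inl i) = (h == leg i);
  interior_trivalent :
    forall v : ivert web_graph,
      #|[set h : half web_graph | tip h == inr v]| = 3%N;
  interior_flow :
    forall v : ivert web_graph,
      (n%:Z %| \sum_(h : half web_graph | tip h == inr v)
                  sigma h * (weight (inl h.1 : edge web_graph))%:Z)%Z;
  boundary_left_to_right :
    forall i i' : 'I_(nbdry web_graph), (i < i')%N -> bpos i < bpos i';
  ipos_below : forall v : ivert web_graph, (ipos v).2 < 0;
  ipos_inj : injective (@ipos _ web_graph);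
  loop_nonempty :
    forall l : loop web_graph, corners (inr l : edge web_graph) != [::];
  edge_below :
    forall (e : edge web_graph) k t,
      inner_param e k t -> (edge_point e k t).2 < 0;
  edge_avoids_ivert :
    forall (e : edge web_graph) k t (v : ivert web_graph),
      inner_param e k t -> edge_point e k t <> ipos v;
  edges_embedded :
    forall (e e' : edge web_graph) k k' t t',
      inner_param e k t -> inner_param e' k' t' ->
      edge_point e k t = edge_point e' k' t' ->
      [/\ e = e', k = k' & t = t'];
}.

Section Strandings.
Variables (R : realType) (n : nat) (G : web R n).

Definition bweight (i : 'I_(nbdry G)) : nat :=
  let l := weight (inl (leg i).1 : edge G) in
  if (leg i).2 then l else (n - l)%N.

(* A dart (e, b) is an edge run along (b = true) or against its direction.     *)
Definition dart : finType := (edge G * bool)%type.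
Definition dart_of (h : half G) : dart := (inl h.1, h.2).

Definition touches (e : edge G) (v : vertex G) : bool :=
  if e is inl a then (tail a == v) || (head a == v) else false.

Definition meet (e e' : edge G) : bool :=
  (e == e') || [exists v, touches e v && touches e' v].

Definition is_bdry (v : vertex G) : bool := if v is inl _ then true else false.

Definition follows (h h' : half G) : bool := tip h == tip (opp h').

(* A strand is identified with the set of darts it runs through, so that a     *)
(* closed path has no distinguished starting point.                            *)
Inductive simple_strand : {set dart} -> Prop :=
| OpenStrand (h : half G) (p : seq (half G)) :
    path follows h p ->
    uniq (tip (opp h) :: map (@tip _ G) (h :: p)) ->
    is_bdry (tip (opp h)) -> is_bdry (tip (last h p)) ->
    simple_strand [set dart_of h' | h' in h :: p]
| ClosedStrand (h : half G) (p : seq (half G)) :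
    cycle follows (h :: p) ->
    uniq (map (@tip _ G) (h :: p)) ->
    uniq (map fst (h :: p)) ->
    simple_strand [set dart_of h' | h' in h :: p]
| LoopStrand (l : loop G) (b : bool) :
    simple_strand [set ((inr l : edge G), b)].

Definition disjoint_strands (A B : {set dart}) : Prop :=
  forall d d', d \in A -> d' \in B -> ~~ meet d.1 d'.1.

(* The colour of a strand is the value of an ordinal of 'I_n, required to be   *)
(* nonzero below.                                                              *)
Definition strand : finType := ('I_n * {set dart})%type.

Definition is_stranding (S : {set strand}) : Prop :=
  (forall s, s \in S -> (0 < s.1)%N /\ simple_strand s.2) /\
  (forall s s', s \in S -> s' \in S -> s != s' -> s.1 = s'.1 ->
     disjoint_strands s.2 s'.2).

Section Colors.
Variable S : {set strand}.

Definition Splus (e : edge G) (c : nat) : bool :=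
  [exists s in S, (s.1 == c :> nat) && ((e, true) \in s.2)].
Definition Sminus (e : edge G) (c : nat) : bool :=
  [exists s in S, (s.1 == c :> nat) && ((e, false) \in s.2)].
Definition Sboth (e : edge G) (c : nat) : bool := Splus e c || Sminus e c.

Definition alpha (e : edge G) (c : nat) : int :=
  if Splus e c then 1 else if Sminus e c then -1 else 0.

(* the largest colour in S(e); 0 when S(e) is empty *)
Definition cmax (e : edge G) : nat := \max_(1 <= c < n | Sboth e c) c.

Definition alternating (e : edge G) : Prop :=
  forall c d : nat, (c < d)%N -> alpha e c != 0 -> alpha e d != 0 ->
    (forall k : nat, (c < k < d)%N -> alpha e k = 0) ->
    alpha e d = - alpha e c.

Definition valid_stranding : Prop :=
  is_stranding S /\
  forall e : edge G,
    [/\ alternating e,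
        exists c, Sboth e c
      & \sum_(1 <= c < n) alpha e c * c%:Z =
          if Splus e (cmax e) then (weight e)%:Z else (weight e)%:Z - n%:Z].

Definition strand_height (i j : nat) (e : edge G) : int :=
  \sum_(i <= c < j) alpha e c.

Definition ij_support (i j : nat) : {set edge G} :=
  [set e | strand_height i j e != 0].

Definition ij_adj (i j : nat) : rel (edge G) :=
  [rel e e' | [&& e \in ij_support i j, e' \in ij_support i j & meet e e']].

Definition ij_strands (i j : nat) : {set {set edge G}} :=
  [set [set e' | connect (ij_adj i j) e e'] | e in ij_support i j].

Definition closed_strand (C : {set edge G}) : bool :=
  [forall e in C, forall v, touches e v ==> ~~ is_bdry v].

(* The shoelace sum: the integral of x dy - y dx along e.         *)
Definition edge_area (e : edge G) : R :=
  let P := polyline e in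
  \sum_(0 <= k < (size P).-1)
     ((nth (0, 0) P k).1 * (nth (0, 0) P k.+1).2
      - (nth (0, 0) P k.+1).1 * (nth (0, 0) P k).2).

(* Twice the signed area enclosed by an (i,j)-strand, directed by the sign of  *)
(* strand_height.  For an open strand this is the area enclosed after joining  *)
(* its end points along the axis y = 0, since segments of the axis contribute  *)
(* nothing.  Positive area means counterclockwise (x to the right, y upwards). *)
Definition strand_area (i j : nat) (C : {set edge G}) : R :=
  \sum_(e in C) (strand_height i j e)%:~R * edge_area e.

Definition clockwise (i j : nat) (C : {set edge G}) : bool :=
  strand_area i j C < 0.
Definition counterclockwise (i j : nat) (C : {set edge G}) : bool :=
  0 < strand_area i j C.

Definition xS : nat :=
  (\sum_(1 <= j < n.+1) \sum_(1 <= i < j)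
     #|[set C in ij_strands i j | closed_strand C && clockwise i j C]|)%N.
Definition yS : nat :=
  (\sum_(1 <= j < n.+1) \sum_(1 <= i < j)
     #|[set C in ij_strands i j | counterclockwise i j C]|)%N.

Definition binary : finType := {ffun 'I_n -> bool}.

Definition last_bit (e : edge G) : bool := alpha e (cmax e) == -1.

(* Entry number c of a binary vector is stored at the ordinal c - 1.  This is  *)
(* the solution of b_n = last_bit and b_c - b_{c+1} = alpha_c; see blabelE,    *)
(* blabel_last and blabel_diff.                                                *)
Definition blabel (e : edge G) : binary :=
  [ffun k : 'I_n =>
     (last_bit e)%:Z + \sum_(k.+1 <= d < n) alpha e d == 1].

Definition bhat (i : 'I_(nbdry G)) : binary :=
  let b := blabel (inl (leg i).1) in
  if (leg i).2 then b else [ffun k => ~~ b k].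

End Colors.

Definition Str : finType := {S : {set strand} | `[< valid_stranding S >]}.

Section BinaryLabels.
Variable S : Str.
Local Notation T := (val S).

Let validS : valid_stranding T.
Proof. by apply/asboolP; exact: (valP S). Qed.

Lemma alpha_neq0 e c : (alpha T e c != 0) = Sboth T e c.
Proof. by rewrite /alpha /Sboth; case: Splus => //; case: Sminus. Qed.

Lemma Sboth_bounds e c : Sboth T e c -> (0 < c < n)%N.
Proof.
have H b : [exists s in T, (s.1 == c :> nat) && ((e, b) \in s.2)] ->
    (0 < c < n)%N.
  case/exists_inP=> s sT /andP[/eqP <- _].
  by case: validS => -[/(_ s sT) [-> _] _] _ /=.
by case/orP; exact: H.
Qed.

Lemma cmax_in e : Sboth T e (cmax T e).
Proof.
have [_ /(_ e) [_ [c cS] _]] := validS.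
have /andP[c0 cn] := Sboth_bounds cS.
suff: cmax T e = 0%N \/ Sboth T e (cmax T e).
  case=> // e0; suff: (0 < cmax T e)%N by rewrite e0.
  by rewrite /cmax (big_rem c) ?mem_index_iota ?c0 //= cS leq_max c0.
rewrite /cmax; elim/big_ind: _ => [|p p' IHp IHp'|p pS]; [by left| |by right].
by rewrite /maxn; case: ifP.
Qed.

Lemma cmax_max e c : Sboth T e c -> (c <= cmax T e)%N.
Proof.
move=> cS; have /andP[c0 cn] := Sboth_bounds cS.
rewrite /cmax (big_rem c) ?mem_index_iota ?c0 //= cS.
exact: leq_maxl.
Qed.

Lemma alpha_tail e k : let a := alpha T e (cmax T e) in
  let s := \sum_(k <= d < n) alpha T e d in
  s = 0 \/ s = a.
Proof.
move=> a; set s := fun k => \sum_(k <= d < n) alpha T e d.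
rewrite -/(s k) /=.
have az d : (cmax T e < d)%N -> alpha T e d = 0.
  move=> lt; apply/eqP; rewrite -[_ == _]negbK alpha_neq0.
  by apply/negP=> /cmax_max; rewrite leqNgt lt.
have s0 d : (cmax T e < d)%N -> s d = 0.
  move=> lt; rewrite /s big_nat big1 // => j /andP[dj _].
  by apply: az; apply: leq_trans dj.
have /andP[_ cn] := Sboth_bounds (cmax_in e).
suff: (cmax T e < k)%N \/ exists d, [/\ (k <= d <= cmax T e)%N,
      alpha T e d != 0, forall j, (k <= j < d)%N -> alpha T e j = 0
    & (s k = 0 /\ alpha T e d = - a) \/ (s k = a /\ alpha T e d = a)].
  case=> [/s0|[d [_ _ _ [[]|[]]]]]; by [left | right].
have [lt|le] := ltnP (cmax T e) k; [by left | right].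
rewrite -(subKn le); move: (cmax T e - k)%N (leq_subr k (cmax T e)) => r.
elim: r => [_|r IH lt].
  rewrite subn0; exists (cmax T e); split.
  - by rewrite !leqnn.
  - by rewrite alpha_neq0 cmax_in.
  - by move=> j /andP[le1 le2]; move: (leq_ltn_trans le1 le2); rewrite ltnn.
  - by right; split=> //; rewrite /s big_ltn // -/(s _) s0 ?addr0.
case: (IH (ltnW lt)) => d [/andP[le1 le2] nz between alt].
have E : (cmax T e - r)%N = (cmax T e - r.+1).+1 by rewrite subnS prednK // subn_gt0.
rewrite E in le1 between alt; set m := (cmax T e - r.+1)%N in le1 between alt *.
have mn : (m < n)%N by apply: leq_ltn_trans cn; apply: leq_subr.
have sE : s m = alpha T e m + s m.+1 by rewrite /s big_ltn.
have [m0|m0] := eqVneq (alpha T e m) 0.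
  exists d; split=> //; first by rewrite (ltnW le1).
    move=> j /andP[]; rewrite leq_eqVlt => /predU1P[<- //|mj jd].
    by apply: between; rewrite mj.
  by rewrite sE m0 add0r.
exists m; split=> //.
- by rewrite leqnn (leq_trans (ltnW le1)).
- by move=> j /andP[h1 h2]; move: (leq_ltn_trans h1 h2); rewrite ltnn.
have [_ /(_ e) [alternS _ _]] := validS.
have := alternS m d le1 m0 nz between.
rewrite sE; case: alt => -[-> ->].
  by move=> /eqP; rewrite eqr_opp => /eqP ->; right; rewrite addr0.
by move=> ->; left; rewrite opprK subrr.
Qed.

Lemma alpha_cmax e :
  alpha T e (cmax T e) = 1 - (last_bit T e).*2%:Z.
Proof.
rewrite /last_bit; have := cmax_in e; rewrite -alpha_neq0 /alpha.
by case: Splus => //; case: Sminus.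
Qed.

Lemma blabelE e (k : 'I_n) :
  (blabel T e k)%:Z = (last_bit T e)%:Z + \sum_(k.+1 <= d < n) alpha T e d.
Proof.
rewrite ffunE; have := alpha_tail e k.+1; rewrite /= alpha_cmax.
by case: (last_bit T e) => -[] ->.
Qed.

Lemma blabel_last e (k : 'I_n) : k.+1 = n -> blabel T e k = last_bit T e.
Proof.
move=> kn; have /eqP := blabelE e k.
by rewrite kn big_geq // addr0 eqz_nat; case: (blabel T e k); case: (last_bit T e).
Qed.

Lemma blabel_diff e (k k' : 'I_n) : k' = k.+1 :> nat ->
  (blabel T e k)%:Z - (blabel T e k')%:Z = alpha T e k.+1.
Proof.
move=> kk'; rewrite !blabelE kk' big_ltn -?kk' ?ltn_ord //.
by rewrite addrCA addrK.
Qed.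

Lemma card_blabel e : #|[set k | blabel T e k]| = weight e.
Proof.
have [_ /(_ e) [_ _ sumE]] := validS.
apply/eqP; rewrite -eqz_nat cardsE -sum1_card big_mkcond /=.
rewrite -natz natr_sum.
under eq_bigr => k _ do
  rewrite -[(if _ then _ else _)%:R]/((blabel T e k : nat)%:R) natz blabelE.
rewrite big_split /= sumr_const card_ord.
suff -> : \sum_(k < n) \sum_(k.+1 <= d < n) alpha T e d
          = \sum_(1 <= c < n) alpha T e c * c%:Z.
  rewrite sumE; have := cmax_in e; rewrite -alpha_neq0.
  rewrite /last_bit /alpha; case: Splus => /=; first by rewrite mul0rn add0r.
  by case: Sminus => //= _; rewrite [X in X + _]natz addrC subrK.
rewrite -(big_mkord xpredT (fun k => \sum_(k.+1 <= d < n) alpha T e d)).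
move: (alpha T e) n => F; elim=> [|N IH]; first by rewrite !big_geq.
rewrite big_nat_recr //= [X in _ + X]big_geq // addr0.
case: N IH => [|N] IH; first by rewrite !big_geq.
rewrite [RHS]big_nat_recr //= -IH.
under eq_big_nat => k /andP[_ kN] do rewrite big_nat_recr //=.
by rewrite big_split /= sumr_const_nat subn0 -mulr_natr natz.
Qed.

Lemma card_bhat (i : 'I_(nbdry G)) : #|[set k | bhat T i k]| = bweight i.
Proof.
rewrite /bhat /bweight; case: (leg i).2; first exact: card_blabel.
set e := inl _; have := cardsC [set k | blabel T e k].
rewrite card_blabel card_ord => cardC.
transitivity #|~: [set k | blabel T e k]|; last first.
  by apply: (canRL (addKn (weight e))).
by apply: eq_card => k; rewrite !inE ffunE.
Qed.

End BinaryLabels.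

(* The standard basis of the k-th quantum exterior power of C_q^n. *)
Definition vbasis (k : nat) : finType := {b : binary | #|[set c | b c]| == k}.

(* C(q) *)
Definition Cq : fieldType := {fraction {poly R[i]}}.
Definition qvar : Cq := tofrac 'X.

(* The monomial basis of V(k), for k the boundary weight vector of G, and V(k) *)
(* itself, as the space of coordinate vectors on this basis.                   *)
Definition monomial : finType :=
  {dffun forall i : 'I_(nbdry G), vbasis (bweight i)}.
Definition tensorV : lmodType Cq := {ffun monomial -> Cq^o}.

Definition basis_vector (x : monomial) : tensorV := [ffun y => (x == y)%:R].

Definition mon (S : Str) : monomial :=
  [ffun i => exist _ (bhat (val S) i) (introT eqP (card_bhat S i))].

Definition web_vector : tensorV :=
  \sum_(S : Str)
    (- qvar) ^ ((xS (val S))%:Z - (yS (val S))%:Z) *: basis_vector (mon S).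

End Strandings.

(* Main.v *)
Require Import Defs.
From HB Require Import structures.
From mathcomp Require Import all_boot all_order all_algebra.
From mathcomp Require Import boolp reals complex.

Set Implicit Arguments.
Unset Strict Implicit.
Unset Printing Implicit Defensive.

Import Order.TTheory GRing.Theory Num.Theory.
Local Open Scope ring_scope.

(* The coefficient of x_S is a nonempty sum of integer powers of -q; no        *)
(* cancellation can occur, since at q = -1 each power takes the value 1.       *)

(** A large power of [-q] clears the negative exponents; the resulting polynomial takes at -1 the
    number of strandings sharing the monomial of [S], which is positive since [S] is one of them. *)

Lemma sum_exp_oppq_neq0 (R : realType) (I : finType) (P : pred I)
    (z : I -> int) (i0 : I) :
  P i0 -> \sum_(i | P i) (- qvar R) ^ z i != 0.
Proof.
move=> Pi0.
have q0 : - qvar R != 0 by rewrite oppr_eq0 tofrac_eq0 polyX_eq0.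
(* [N] bounds every [absz (z i)], so each [z i + N] is nonnegative. *)
pose N := (\sum_i absz (z i))%N.
pose m i := absz (z i + N%:Z).
have mE i : (m i)%:Z = z i + N%:Z.
  rewrite /m gez0_abs // -lerBlDl sub0r (le_trans (ler_norm _)) // normrN.
  by rewrite -abszE lez_nat /N (bigD1 i) //= leq_addr.
suff: \sum_(i | P i) (- qvar R) ^ z i * (- qvar R) ^ N%:Z != 0.
  by rewrite -mulr_suml mulf_eq0 => /norP[].
under eq_bigr => i _ do
  rewrite -expfzDr // -mE -exprnP -tofracN -tofracXn.
rewrite -rmorph_sum tofrac_eq0 /=; apply/eqP => /(congr1 (horner^~ (-1))).
rewrite horner_sum horner0.
under eq_bigr => i _ do rewrite horner_exp hornerN hornerX opprK expr1n.
(* The value at -1 is the cardinal of [P], nonzero in characteristic 0. *)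
rewrite sumr_const => /eqP; rewrite pnatr_eq0 => /eqP/card0_eq/(_ i0).
by rewrite unfold_in Pi0.
Qed.

Theorem theorem51 (R : realType) (n : nat) (hn : (2 <= n)%N) (G : web R n)
    (S : Str G) :
  web_vector G (mon S) != 0.
Proof.
rewrite /web_vector sum_ffunE.
under eq_bigr => T _ do rewrite !ffunE.
under eq_bigr => T _ do rewrite /GRing.scale /= mulr_natr mulrb.
(* Only the strandings [T] with [mon T = mon S] remain. *)
by rewrite -big_mkcond; apply: (@sum_exp_oppq_neq0 _ _ _ _ S) => /=.
Qed.
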